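(* Let $G$ be a connected graph of order $n\ge 2$. Then $\gamma_{rdR}(G)\le 2n-1$, with equality if and only if $n=2$.
   Context: All graphs are finite and simple. A restrained double Roman dominating function (RDRD function) of a graph $G$ is a function $f:V(G)\to\{0,1,2,3\}$ such that, with $V_i=\{v\in V(G): f(v)=i\}$: (a) every vertex $v\in V_0$ has at least two neighbors in $V_2$ or at least one neighbor in $V_3$; (b) every vertex $v\in V_1$ has at least one neighbor in $V_2\cup V_3$; (c) the induced subgraph $G[V_0]$ has no isolated vertex. The weight of $f$ is $\sum_{v\in V(G)} f(v)$, and $\gamma_{rdR}(G)$ is the minimum weight of an RDRD function of $G$. *)

(* Defs.v *)
From mathcomp Require Import all_boot.

Set Implicit Arguments.
Unset Strict Implicit.
Unset Printing Implicit Defensive.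

Record sgraph := SGraph {
  vertex :> finType;
  adj : rel vertex;
  adj_sym : symmetric adj;
  adj_irrefl : irreflexive adj }.

(* The empty graph counts as connected here. *)
Definition connected (G : sgraph) : Prop :=
  forall x y : G, connect (@adj G) x y.

Definition neighbors (G : sgraph) (v : G) : {set G} :=
  [set u | adj v u].

Definition isolated (G : sgraph) (v : G) : bool := neighbors v == set0.

Section Induced.
Variables (G : sgraph) (S : {set G}).

Definition induced_adj : rel {x : G | x \in S} :=
  fun x y => adj (val x) (val y).

Lemma induced_adj_sym : symmetric induced_adj.
Proof. by move=> x y; apply: adj_sym. Qed.

Lemma induced_adj_irrefl : irreflexive induced_adj.
Proof. by move=> x; apply: adj_irrefl. Qed.

Definition induced : sgraph := SGraph induced_adj_sym induced_adj_irrefl.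
End Induced.

Section RestrainedDoubleRoman.
Variable G : sgraph.
Implicit Types (f : {ffun G -> 'I_4}) (v : G).

Definition level f (i : nat) : {set G} := [set v | f v == i :> nat].

Definition is_RDRD f : bool :=
  [&& [forall v in level f 0,
         (2 <= #|neighbors v :&: level f 2|)
         || (1 <= #|neighbors v :&: level f 3|)],
      [forall v in level f 1,
         1 <= #|neighbors v :&: (level f 2 :|: level f 3)|]
    & [forall v : induced (level f 0), ~~ isolated v]].

Definition weight f : nat := \sum_(v : G) f v.

Definition RDRD_weight (w : nat) : bool :=
  [exists f : {ffun G -> 'I_4}, is_RDRD f && (weight f == w)].

(* Witness: the constant function 2. *)
Lemma RDRD_weight_exists : exists w, RDRD_weight w.
Proof.
pose f : {ffun G -> 'I_4} := [ffun=> inord 2].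
have fE v : f v = 2 :> nat by rewrite ffunE inordK.
exists (weight f); apply/existsP; exists f; rewrite eqxx andbT.
apply/and3P; split; apply/forallP => v.
- by rewrite inE fE.
- by rewrite inE fE.
- by case: v => v v0; exfalso; move: v0; rewrite inE fE.
Qed.

Definition gamma_rdR : nat := ex_minn RDRD_weight_exists.
End RestrainedDoubleRoman.

(* Main.v *)
Require Import Defs.
From mathcomp Require Import all_boot.

(** Assigning 1 to the neighbours of a vertex [v] and 2 elsewhere gives an RDRD
    function of weight [2 n - deg v].  A connected graph of order at least 2 has a
    vertex of degree at least 1, and of degree at least 2 when the order is at least 3.
    Conversely, a vertex of value 0 has a neighbour of value 0 and one of value at
    least 2, so for [n = 2] all values are positive, and some value is at least 2. *)

Section Graph.
Variable G : sgraph.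
Implicit Types (u v w : G) (f : {ffun G -> 'I_4}).

Lemma gamma_rdR_le_weight f : is_RDRD f -> gamma_rdR G <= weight f.
Proof.
move=> Hf; rewrite /gamma_rdR; case: ex_minnP => m _; apply.
by apply/existsP; exists f; rewrite Hf eqxx.
Qed.

Lemma gamma_rdR_attained : exists2 f : {ffun G -> 'I_4}, is_RDRD f & weight f = gamma_rdR G.
Proof.
rewrite /gamma_rdR; case: ex_minnP => m /existsP[f /andP[Hf /eqP Hw]] _.
by exists f.
Qed.

Lemma gamma_rdR_degree v : gamma_rdR G + #|neighbors v| <= 2 * #|G|.
Proof.
(* The boolean [adj v u] is read as 0 or 1. By irreflexivity [v] itself keeps the value 2, so it
   serves every vertex of value 1 in condition (b). *)
pose f : {ffun G -> 'I_4} := [ffun u => inord (2 - adj v u)].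
have fE u : f u = 2 - adj v u :> nat.
  by rewrite ffunE inordK //; case: (adj v u).
have f_neq0 u : (f u == 0 :> nat) = false by rewrite fE; case: (adj v u).
have f_RDRD : is_RDRD f.
  apply/and3P; split; apply/forallP => u.
  - by rewrite inE f_neq0.
  - apply/implyP; rewrite inE fE => Hu; apply/card_gt0P; exists v.
    have vu : adj v u by case: (adj v u) Hu.
    by rewrite !inE fE adj_irrefl adj_sym vu.
  - by case: u => u u0; exfalso; move: u0; rewrite inE f_neq0.
apply: (leq_trans (leq_add (gamma_rdR_le_weight _ f_RDRD) (leqnn _))).
(* The degree becomes a sum of indicators over all vertices; at each [u], [f u] plus the indicator
   of [adj v u] is 2. *)
rewrite /weight cardsE -sum1_card [X in _ + X]big_mkcond -big_split /=.
rewrite mulnC -sum_nat_const; apply: leq_sum => u _.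
by rewrite fE /in_mem /=; case: (adj v u).
Qed.

Lemma exists_adj : connected G -> 2 <= #|G| -> exists u v : G, adj u v.
Proof.
move=> connG /card_gt1P[x [y [_ _ xy]]].
case/connectP: (connG x y) => -[|z p] /=; first by move=> _ yx; rewrite yx eqxx in xy.
by case/andP=> xz _ _; exists x, z.
Qed.

(** If all degrees were at most 1, the two ends of any edge would form a set closed under adjacency,
    hence the whole graph by connectedness. *)
Lemma exists_degree_ge2 :
  connected G -> 3 <= #|G| -> exists v : G, 2 <= #|neighbors v|.
Proof.
move=> connG n3; apply/existsP; apply: contraLR n3.
rewrite negb_exists -leqNgt => /forallP deg_le1.
case: (ltnP 1 #|G|) => [n2|/leqW //].
have [u [v uv]] := exists_adj connG n2.
have nbr_uniq (x y z : G) : adj x y -> adj x z -> y = z.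
  have := deg_le1 x; rewrite -leqNgt => /card_le1_eqP inj xy xz.
  by apply: inj; rewrite inE.
have edge_closed : closed (@adj G) [set u; v].
  apply: intro_closed => [x y|x y xy]; first exact/sym_connect_sym/adj_sym.
  rewrite !inE => /orP[] /eqP xE; move: xy; rewrite xE => xy.
  - by rewrite (nbr_uniq _ _ _ xy uv) eqxx orbT.
  - by rewrite (nbr_uniq v y u) ?eqxx // adj_sym.
have <- : #|[set u; v]| = #|G|.
  apply: eq_card => x.
  by rewrite -(closed_connect edge_closed (connG u x)) !inE eqxx.
by rewrite cards2; case: (u != v).
Qed.

(** At a vertex of value 0, condition (c) gives a neighbour of value 0 and (a) one of nonzero value:
    three distinct vertices, too many here. *)
Lemma RDRD_pos f v : is_RDRD f -> #|G| <= 2 -> 0 < f v.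
Proof.
move=> /and3P[/forallP zero _ /forallP iso] n2; rewrite lt0n; apply/negP => v0.
have vL : v \in level f 0 by rewrite inE.
have /set0Pn[[u uL] vu] := iso (exist _ v vL).
have {}vu : adj v u by move: vu; rewrite inE.
have [w vw fw] : exists2 w, adj v w & f w != 0 :> nat.
  have := zero v; rewrite vL => /orP[/ltnW|] /card_gt0P[w];
    by rewrite !inE => /andP[vw /eqP fw]; exists w; rewrite ?fw.
have : 2 < #|G|.
  apply/card_gt2P; exists v, u, w; split=> //; split.
  - by apply: contraTneq vu => ->; rewrite adj_irrefl.
  - by apply: contraNneq fw => <-; move: uL; rewrite inE.
  - by apply: contraNneq fw => ->.
by rewrite ltnNge n2.
Qed.

Lemma RDRD_ge2 f v : is_RDRD f -> (forall u, 0 < f u) -> exists w, 2 <= f w.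
Proof.
move=> /and3P[_ /forallP one _] f_gt0.
have [|f_le1] := ltnP 1 (f v); first by exists v.
have := one v; rewrite inE eqn_leq f_le1 f_gt0 /= => /card_gt0P[w].
by rewrite !inE => /andP[_ /orP[]/eqP fw]; exists w; rewrite fw.
Qed.

Lemma weight_gt_card f :
  (forall u, 0 < f u) -> (exists w, 2 <= f w) -> #|G| < weight f.
Proof.
(* The term of [w] is split off both sums: there 2 beats 1, and elsewhere each value is at least
   1. *)
move=> f_gt0 [w fw]; rewrite /weight (bigD1 w) //= -sum1_card (bigD1 w) //=.
by rewrite -addSn leq_add // leq_sum.
Qed.

End Graph.

Theorem proposition6 (G : sgraph) (connG : connected G) (hn : 2 <= #|G|) :
  gamma_rdR G <= 2 * #|G| - 1
  /\ (gamma_rdR G = 2 * #|G| - 1 <-> #|G| = 2).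
Proof.
have [u [v uv]] := exists_adj _ connG hn.
have upper : gamma_rdR G <= 2 * #|G| - 1.
  rewrite leq_subRL ?muln_gt0 ?(ltnW hn) // addnC.
  apply: leq_trans (gamma_rdR_degree _ u); rewrite leq_add2l.
  by apply/card_gt0P; exists v; rewrite inE.
split=> //; split=> [gammaE|n2].
  apply/eqP; rewrite eqn_leq hn andbT leqNgt; apply/negP => n3.
  have [x deg_x] := exists_degree_ge2 _ connG n3.
  (* A degree of at least 2 would give [(2 * #|G| - 1) + 2 <= 2 * #|G|]. *)
  have := leq_trans (leq_add (leqnn _) deg_x) (gamma_rdR_degree _ x).
  by rewrite gammaE addn2 subn1 prednK ?ltnn // muln_gt0 (ltnW hn).
(* For order 2 the bound is 3, one more than the order, so a weight above the order suffices. *)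
apply/eqP; rewrite eqn_leq upper n2 /=.
have [f f_RDRD <-] := gamma_rdR_attained G.
have f_gt0 x : 0 < f x by apply: RDRD_pos; rewrite ?n2.
have := weight_gt_card _ _ f_gt0 (RDRD_ge2 _ _ u f_RDRD f_gt0).
by rewrite n2.
Qed.
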